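(* Let $a_1,a_2>0$, $\beta=a_1+a_2$, $0<p<q$, $0<\ell<u<+\infty$, and $f:\mathbb{R}_+^2\to\mathbb{R}_+$, $f(x)=x_1^{a_1}x_2^{a_2}$. Let $X=\{x\in\mathbb{R}_+^2:\ell\le f(x)\le u\}$ and $W_{12}=\{x\in\mathbb{R}^2_+: p x_1\le x_2\le q x_1\}$. Let $z_0,\gamma,\lambda,d_1,d_2$ and $Y$ be as defined in the context. Then the upper envelope of $f$ over $X\cap W_{12}$ is $$E_U(f,X\cap W_{12})=\{(x,z)\in Y\times\mathbb{R}:\ z\le f_u(x),\ z\le u\},$$ where $f_u(x)=z_0+\left(\gamma x_1^{a_1}x_2^{a_2}\right)^{1/\beta}$ if $\beta\ge 1$, and $f_u(x)=f(x)$ otherwise.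
   Context: $\mathbb{R}_+$ denotes the nonnegative reals. For $T\subseteq\mathbb{R}^n$ and a real-valued function $f$ defined on $T$, the hypograph of $f$ in $T$ is $\mathrm{hyp}(f,T)=\{(x,z)\in T\times\mathbb{R}: z\le f(x)\}$, and the upper envelope $E_U(f,T)$ is the convex hull of $\mathrm{hyp}(f,T)$. Constants: $z_0=\dfrac{u^{1/\beta}\ell-\ell^{1/\beta}u}{u^{1/\beta}-\ell^{1/\beta}}$, $\gamma=\left(\dfrac{u-\ell}{u^{1/\beta}-\ell^{1/\beta}}\right)^{\beta}$, $d_1=q^{-a_2/(a_1+a_2)}-p^{-a_2/(a_1+a_2)}$, $d_2=q^{a_1/(a_1+a_2)}-p^{a_1/(a_1+a_2)}$, $\lambda=\dfrac{p^{a_2}}{(d_2-d_1p)^{a_1+a_2}}$. Set: $Y=\{x\in\mathbb{R}_+^2:\ p x_1\le x_2\le q x_1,\ x_1^{a_1}x_2^{a_2}\ge \ell,\ d_2x_1-d_1x_2\le (u/\lambda)^{1/\beta}\}$. *)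

(* Defs.v *)
From HB Require Import structures.
From mathcomp Require Import all_boot all_order all_algebra.
From mathcomp Require Import boolp classical_sets reals exp convex.

Set Implicit Arguments.
Unset Strict Implicit.
Unset Printing Implicit Defensive.

Import Order.TTheory GRing.Theory Num.Theory.

Local Open Scope classical_set_scope.
Local Open Scope ring_scope.

(* Points of R^n are row vectors; a point (x, z) of the graph space R^n x R is
   a pair in the product lmodule 'rV[R]_n * R^o (R^o is R as a module over
   itself). Coordinates are numbered from 0: x_1 is x 0 0 and x_2 is x 0 1. *)

Definition convex_hull (R : realType) (M : lmodType R) (A : set M) : set M :=
  smallest (@convex_set R M) A.

Definition hypograph (R : realType) (n : nat) (f : 'rV[R]_n -> R)
    (T : set 'rV[R]_n) : set ('rV[R]_n * R^o)%type :=
  [set xz | T xz.1 /\ (xz.2 : R) <= f xz.1].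

Definition upper_envelope (R : realType) (n : nat) (f : 'rV[R]_n -> R)
    (T : set 'rV[R]_n) : set ('rV[R]_n * R^o)%type :=
  convex_hull (hypograph f T).

Definition nonneg_orthant (R : realType) (n : nat) : set 'rV[R]_n :=
  [set x | forall i, 0 <= x 0 i].

Arguments nonneg_orthant R n : clear implicits.

(* This total function carries its intended meaning on the nonnegative quadrant
   only; every set below on which it is used lies in that quadrant. *)
Definition monomial (R : realType) (a1 a2 : R) (x : 'rV[R]_2) : R :=
  (x 0 0) `^ a1 * (x 0 1) `^ a2.

Definition set_X (R : realType) (a1 a2 l u : R) : set 'rV[R]_2 :=
  [set x | nonneg_orthant R 2 x /\ l <= monomial a1 a2 x <= u].

Definition set_W12 (R : realType) (p q : R) : set 'rV[R]_2 :=
  [set x | nonneg_orthant R 2 x /\ p * x 0 0 <= x 0 1 <= q * x 0 0].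

Definition z0 (R : realType) (beta l u : R) : R :=
  (u `^ (1 / beta) * l - l `^ (1 / beta) * u) /
    (u `^ (1 / beta) - l `^ (1 / beta)).

Definition gamma (R : realType) (beta l u : R) : R :=
  ((u - l) / (u `^ (1 / beta) - l `^ (1 / beta))) `^ beta.

Definition d1 (R : realType) (a1 a2 p q : R) : R :=
  q `^ (- a2 / (a1 + a2)) - p `^ (- a2 / (a1 + a2)).

Definition d2 (R : realType) (a1 a2 p q : R) : R :=
  q `^ (a1 / (a1 + a2)) - p `^ (a1 / (a1 + a2)).

Definition lambda (R : realType) (a1 a2 p q : R) : R :=
  p `^ a2 / (d2 a1 a2 p q - d1 a1 a2 p q * p) `^ (a1 + a2).

Definition set_Y (R : realType) (a1 a2 p q l u : R) : set 'rV[R]_2 :=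
  [set x | [/\ nonneg_orthant R 2 x,
               p * x 0 0 <= x 0 1 <= q * x 0 0,
               l <= (x 0 0) `^ a1 * (x 0 1) `^ a2
             & d2 a1 a2 p q * x 0 0 - d1 a1 a2 p q * x 0 1
                 <= (u / lambda a1 a2 p q) `^ (1 / (a1 + a2))]].

Definition f_u (R : realType) (a1 a2 l u : R) (x : 'rV[R]_2) : R :=
  let beta := a1 + a2 in
  if 1 <= beta then
    z0 beta l u
      + (gamma beta l u * ((x 0 0) `^ a1 * (x 0 1) `^ a2)) `^ (1 / beta)
  else monomial a1 a2 x.

(* Main.v *)
Require Import Defs.
From HB Require Import structures.
From mathcomp Require Import all_boot all_order all_algebra.
From mathcomp Require Import boolp classical_sets reals exp convex.
From mathcomp Require Import interval_inference ring lra.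

Import Order.TTheory GRing.Theory Num.Theory.
Local Open Scope classical_set_scope.
Local Open Scope ring_scope.

(* Put g = f^(1/beta), which is concave and positively homogeneous of degree 1,
   m = l^(1/beta), M = u^(1/beta). The right-hand side is convex and contains
   the hypograph since g is concave, dominates its chord between the two extreme
   rays of the cone, and t |-> t^beta lies below its secant on [m, M] when
   beta >= 1 (while f itself is concave when beta < 1).
   Conversely let (x, z) satisfy the inequalities. If g(x) <= M and beta >= 1,
   then x lies between its multiples (m/g(x)) x and (M/g(x)) x, where f equals l
   and u, and f_u is affine along this ray. If g(x) > M, then x lies in the
   triangle whose vertices are (M/g(x)) x and the two points of the extreme rays
   at which f = u. *)

(** * Segments along rays and concavity of power products *)

Section Preliminaries.
Set Implicit Arguments.
Unset Strict Implicit.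
Context {R : realType}.
Implicit Types (a b r s t x y : R).

Lemma forall_ord2 (P : 'I_2 -> Prop) : P 0 -> P 1 -> forall i, P i.
Proof.
move=> P0 P1 [[|[|//]] hi].
  by rewrite (_ : Ordinal hi = 0)//; exact: val_inj.
by rewrite (_ : Ordinal hi = 1)//; exact: val_inj.
Qed.

Lemma rV2P (v w : 'rV[R]_2) : v 0 0 = w 0 0 -> v 0 1 = w 0 1 -> v = w.
Proof. by move=> h0 h1; apply/rowP; exact: forall_ord2. Qed.

Lemma nonneg_orthant2P (v : 'rV[R]_2) :
  nonneg_orthant R 2 v <-> 0 <= v 0 0 /\ 0 <= v 0 1.
Proof. by split=> [v0|[h0 h1]]; [split; exact: v0|exact: forall_ord2]. Qed.

Lemma convex_graph_space n (A : set ('rV[R]_n * R^o)%type) (v w : 'rV[R]_n)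
    x y t :
  convex_set A -> A (v, x) -> A (w, y) -> 0 <= t -> t <= 1 ->
  A (t *: v + (1 - t) *: w, t * x + (1 - t) * y).
Proof.
move=> cA Av Aw t0 t1.
have t01 : 0 <= t <= 1 by rewrite t0.
exact: (set_mem (cA (v, x) (w, y) (Itv01 t0 t1) (mem_set Av) (mem_set Aw))).
Qed.

(** The weights [(b - 1) / (b - a)] and [(1 - a) / (b - a)] write 1 as a combination of [a] and [b];
    the equation for [z] is the same combination with denominators cleared. *)
Lemma convex_ray n (A : set ('rV[R]_n * R^o)%type) (v : 'rV[R]_n) a b x y z :
  convex_set A -> a <= 1 -> 1 <= b -> a < b ->
  A (a *: v, x) -> A (b *: v, y) ->
  z * (b - a) = x * (b - 1) + y * (1 - a) -> A (v, z).
Proof.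
move=> cA a1 b1 ab Ax Ay ez.
have ba : 0 < b - a by rewrite subr_gt0.
have -> : z = (b - 1) / (b - a) * x + (1 - (b - 1) / (b - a)) * y.
  apply: (mulIf (lt0r_neq0 ba)); rewrite ez; field.
  exact: lt0r_neq0.
have -> : v = (b - 1) / (b - a) *: (a *: v)
    + (1 - (b - 1) / (b - a)) *: (b *: v).
  rewrite !scalerA -scalerDl -[LHS]scale1r; congr (_ *: _).
  by field; exact: lt0r_neq0.
apply: convex_graph_space => //.
  by rewrite divr_ge0 ?subr_ge0// ltW.
by rewrite ler_pdivrMr// mul1r; lra.
Qed.

Lemma lnB_le x y : 0 < x -> 0 < y -> ln x <= ln y + (x / y - 1).
Proof.
move=> x0 y0; rewrite -lerBlDl -ln_div ?posrE//.
have xy : 0 < x / y by rewrite divr_gt0.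
by rewrite -[x / y](subrKC 1) [leRHS]addrAC subrr add0r le_ln1Dx//; lra.
Qed.

(** Weighted AM-GM for [x], [y] and 1 with weights [a], [b] and [1 - a - b]. After taking
    logarithms, the tangent of [ln] at the mean [A] bounds each term. *)
Lemma powRM_le_mean a b x y :
  0 <= a -> 0 <= b -> a + b <= 1 -> 0 < x -> 0 < y ->
  x `^ a * y `^ b <= 1 + a * (x - 1) + b * (y - 1).
Proof.
move=> a0 b0 ab x0 y0; set A := 1 + _ + _.
have A0 : 0 < A.
  have -> : A = (1 - a - b) + a * x + b * y by rewrite /A; ring.
  have ax : 0 <= a * x by rewrite mulr_ge0// ltW.
  have by_ : 0 <= b * y by rewrite mulr_ge0// ltW.
  (* The three weights sum to 1, so one of them is positive. *)
  have [ap|ap] := ltP 0 a; first by have := mulr_gt0 ap x0; lra.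
  have [bp|bp] := ltP 0 b; first by have := mulr_gt0 bp y0; lra.
  lra.
rewrite /powR !gt_eqF// -expRD -[leRHS]lnK ?posrE// ler_expR.
have hx := ler_wpM2l a0 (lnB_le x0 A0).
have hy := ler_wpM2l b0 (lnB_le y0 A0).
have h1 : 0 <= (1 - a - b) * (ln A + (1 / A - 1)).
  by rewrite mulr_ge0//; [lra|have := lnB_le ltr01 A0; rewrite ln1].
(* The weighted mean of [x / A], [y / A] and [1 / A] is 1, so the tangent corrections cancel. *)
have -> : ln A = a * (ln A + (x / A - 1)) + b * (ln A + (y / A - 1))
   + (1 - a - b) * (ln A + (1 / A - 1)).
  have : A / A = 1 by rewrite divff// gt_eqF.
  rewrite {1}/A => e.
  transitivity (ln A + ((1 + a * (x - 1) + b * (y - 1)) / A - 1)); last ring.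
  by rewrite e; ring.
lra.
Qed.

(** Rescaling by [r] and [s] moves the previous bound from (1, 1) to the tangent plane at
    [(r, s)]. *)
Lemma powRM_le_tangent a b x y r s :
  0 <= a -> 0 <= b -> a + b <= 1 -> 0 < x -> 0 < y -> 0 < r -> 0 < s ->
  x `^ a * y `^ b
    <= r `^ a * s `^ b * (1 + a * (x / r - 1) + b * (y / s - 1)).
Proof.
move=> a0 b0 ab x0 y0 r0 s0.
have {1}-> : x = r * (x / r) by field; rewrite gt_eqF.
have {1}-> : y = s * (y / s) by field; rewrite gt_eqF.
have xr : 0 < x / r by exact: divr_gt0.
have ys : 0 < y / s by exact: divr_gt0.
rewrite (powRM _ (ltW r0) (ltW xr)) (powRM _ (ltW s0) (ltW ys)) mulrACA.
rewrite ler_wpM2l ?mulr_ge0 ?powR_ge0//.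
exact: powRM_le_mean.
Qed.

Lemma conv_gt0 t x y :
  0 <= t -> t <= 1 -> 0 < x -> 0 < y -> 0 < t * x + (1 - t) * y.
Proof.
move=> t0 t1 x0 y0; have [tp|tp] := ltP 0 t.
  by rewrite ltr_wpDr ?mulr_gt0// mulr_ge0 ?subr_ge0// ltW.
have -> : t = 0 by lra.
lra.
Qed.

(** Both endpoints lie below the tangent plane at their combination [(r, s)]; in the average the
    first-order terms vanish. *)
Lemma powRM_concave a b t x1 y1 x2 y2 :
  0 <= a -> 0 <= b -> a + b <= 1 -> 0 <= t -> t <= 1 ->
  0 < x1 -> 0 < y1 -> 0 < x2 -> 0 < y2 ->
  t * (x1 `^ a * y1 `^ b) + (1 - t) * (x2 `^ a * y2 `^ b)
    <= (t * x1 + (1 - t) * x2) `^ a * (t * y1 + (1 - t) * y2) `^ b.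
Proof.
move=> a0 b0 ab t0 t1 x10 y10 x20 y20.
set r := t * x1 + _; set s := t * y1 + _.
have r0 : 0 < r by exact: conv_gt0.
have s0 : 0 < s by exact: conv_gt0.
have h1 := powRM_le_tangent a0 b0 ab x10 y10 r0 s0.
have h2 := powRM_le_tangent a0 b0 ab x20 y20 r0 s0.
set F := r `^ a * s `^ b in h1 h2 *.
have er : t * (x1 / r) + (1 - t) * (x2 / r) = 1.
  by rewrite !mulrA -mulrDl divff// gt_eqF.
have es : t * (y1 / s) + (1 - t) * (y2 / s) = 1.
  by rewrite !mulrA -mulrDl divff// gt_eqF.
have t1' : 0 <= 1 - t by lra.
have -> : F = t * (F * (1 + a * (x1 / r - 1) + b * (y1 / s - 1)))
   + (1 - t) * (F * (1 + a * (x2 / r - 1) + b * (y2 / s - 1))).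
  transitivity (F * (1 + a * ((t * (x1 / r) + (1 - t) * (x2 / r)) - 1)
     + b * ((t * (y1 / s) + (1 - t) * (y2 / s)) - 1))); last ring.
  by rewrite er es; ring.
by rewrite lerD// ler_wpM2l.
Qed.

Lemma powR_concave a t x y :
  0 <= a -> a <= 1 -> 0 <= t -> t <= 1 -> 0 < x -> 0 < y ->
  t * x `^ a + (1 - t) * y `^ a <= (t * x + (1 - t) * y) `^ a.
Proof.
move=> a0 a1 t0 t1 x0 y0.
have := @powRM_concave a 0 t x 1 y 1 a0 (lexx 0).
rewrite !powRr0 !mulr1 addr0; exact.
Qed.

End Preliminaries.

(** * The Cobb-Douglas function on the cone: homogeneity, chord and secant bounds *)

Section Envelope.
Set Implicit Arguments.
Unset Strict Implicit.
Context {R : realType}.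
Variables (a1 a2 p q l u : R).
Hypotheses (ha1 : 0 < a1) (ha2 : 0 < a2) (hp : 0 < p) (hpq : p < q).
Hypotheses (hl : 0 < l) (hlu : l < u).
Implicit Types (t x y z : R).

Local Notation beta := (a1 + a2).
Local Notation b1 := (a1 / beta).
Local Notation b2 := (a2 / beta).
Local Notation F x y := (x `^ a1 * y `^ a2).
Local Notation G x y := (x `^ b1 * y `^ b2).
Local Notation m := (l `^ (1 / beta)).
Local Notation M := (u `^ (1 / beta)).
Local Notation slope := ((u - l) / (M - m)).
(* Up to the factor [q - p], the function that is linear on the cone
   [p x <= y <= q x] and agrees with [G] on its two extreme rays. *)
Local Notation chord x y := (p `^ b2 * (q * x - y) + q `^ b2 * (y - p * x)).

Let beta_gt0 : 0 < beta. Proof. exact: addr_gt0. Qed.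
Let q_gt0 : 0 < q. Proof. exact: lt_trans hpq. Qed.
Let u_gt0 : 0 < u. Proof. exact: lt_trans hlu. Qed.
Let b1_gt0 : 0 < b1. Proof. exact: divr_gt0. Qed.
Let b2_gt0 : 0 < b2. Proof. exact: divr_gt0. Qed.
Let b1D : b1 + b2 = 1. Proof. by rewrite -mulrDl divff// gt_eqF. Qed.
Let m_gt0 : 0 < m. Proof. exact: powR_gt0. Qed.

Let m_lt_M : m < M.
Proof. by apply: gt0_ltr_powR; rewrite ?nnegrE ?divr_gt0 ?ltW. Qed.

Let slope_gt0 : 0 < slope. Proof. by rewrite divr_gt0 ?subr_gt0. Qed.

Lemma cobb_douglas_root x y : 0 <= x -> 0 <= y -> F x y `^ (1 / beta) = G x y.
Proof.
by move=> x0 y0; rewrite powRM ?powR_ge0// -!powRrM !mulrA !mulr1.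
Qed.

Lemma cobb_douglasE x y : 0 <= x -> 0 <= y -> F x y = G x y `^ beta.
Proof.
move=> x0 y0; rewrite -cobb_douglas_root// -powRrM mul1r mulVf ?gt_eqF//.
by rewrite powRr1// mulr_ge0 ?powR_ge0.
Qed.

Lemma powR_rootK x : 0 <= x -> (x `^ (1 / beta)) `^ beta = x.
Proof. by move=> x0; rewrite -powRrM mul1r mulVf ?gt_eqF// powRr1. Qed.

Lemma cobb_douglasZ t x y : 0 <= t -> 0 <= x -> 0 <= y ->
  F (t * x) (t * y) = t `^ beta * F x y.
Proof.
move=> t0 x0 y0; rewrite !powRM// powRD; first ring.
by rewrite gt_eqF.
Qed.

Lemma root_leE x y z : 0 <= x -> 0 <= y -> 0 <= z ->
  (z <= F x y) = (z `^ (1 / beta) <= G x y).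
Proof.
move=> x0 y0 z0; rewrite -cobb_douglas_root//.
have F0 : 0 <= F x y by rewrite mulr_ge0 ?powR_ge0.
apply/idP/idP => h; first by apply: ge0_ler_powR; rewrite ?nnegrE ?divr_ge0// ?ltW.
rewrite leNgt; apply/negP => /gt0_ltr_powR - /(_ (1 / beta)).
by rewrite !nnegrE divr_gt0// => /(_ isT F0 z0); rewrite ltNge h.
Qed.

(** Takes points with [l <= F x y] off the axes, as the concavity lemmas require. *)
Lemma cobb_douglas_gt0 x y : 0 <= x -> 0 <= y -> 0 < F x y -> 0 < x /\ 0 < y.
Proof.
move=> x0 y0 F0; split; rewrite lt_neqAle ?x0 ?y0 andbT eq_sym;
  by apply: contraTneq F0 => ->; rewrite powR0 ?gt_eqF// ?mul0r ?mulr0 ltxx.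
Qed.

Lemma chord_le x y : 0 < x -> p * x <= y -> y <= q * x ->
  chord x y <= (q - p) * G x y.
Proof.
move=> x0 pxy yqx; pose t := y / x.
have ey : y = x * t by rewrite /t mulrC divfK// gt_eqF.
have pt : p <= t by rewrite ler_pdivlMr.
have tq : t <= q by rewrite ler_pdivrMr.
have qp : 0 < q - p by rewrite subr_gt0.
have t0 : 0 < t by exact: lt_le_trans pt.
have -> : G x y = x * t `^ b2.
  rewrite ey powRM ?ltW// mulrA -powRD ?b1D ?powRr1 ?ltW//.
  by rewrite gt_eqF ?implybT.
have h := @powR_concave R b2 ((q - t) / (q - p)) p q (ltW b2_gt0).
have {}h : (q - t) / (q - p) * p `^ b2 + (1 - (q - t) / (q - p)) * q `^ b2
    <= t `^ b2.
  have {3}-> : t = (q - t) / (q - p) * p + (1 - (q - t) / (q - p)) * q.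
    by field; rewrite gt_eqF.
  apply: h => //; last by rewrite ler_pdivrMr// mul1r lerB.
    by rewrite -b1D lerDr ltW.
  by rewrite divr_ge0 ?subr_ge0// ltW.
have -> : chord x y = (q - p) * (x * ((q - t) / (q - p) * p `^ b2
    + (1 - (q - t) / (q - p)) * q `^ b2)).
  by rewrite ey; field; rewrite gt_eqF.
by rewrite !ler_wpM2l// ltW.
Qed.

(** The linear form on the left is [chord x y] divided by [p]^ b2 * q [^ b2]. Since [lambda] is
    [F 1 p] over the [beta]-th power of this form at (1, p), the bound is the value of the form
    where the ray of slope [p] meets [F = u]. *)
Lemma set_Y_chordE x y :
  (d2 a1 a2 p q * x - d1 a1 a2 p q * y
     <= (u / lambda a1 a2 p q) `^ (1 / beta)) = (chord x y <= (q - p) * M).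
Proof.
have P0 : 0 < p `^ b2 by exact: powR_gt0.
have Q0 : 0 < q `^ b2 by exact: powR_gt0.
have ed1 : d1 a1 a2 p q = (q `^ b2)^-1 - (p `^ b2)^-1.
  by rewrite /d1 mulNr !powRN.
have eb1 : b1 = 1 - b2 by rewrite -b1D addrK.
have powRb1 x' : 0 < x' -> x' `^ b1 = x' / x' `^ b2.
  by move=> x0; rewrite eb1 powRB ?powRr1// ?ltW// (gt_eqF x0) implybT.
have ed2 : d2 a1 a2 p q = q / q `^ b2 - p / p `^ b2 by rewrite /d2 !powRb1.
have eD : d2 a1 a2 p q - d1 a1 a2 p q * p = (q - p) / q `^ b2.
  by rewrite ed1 ed2; field; rewrite !gt_eqF.
have qp : 0 < q - p by rewrite subr_gt0.
have L0 : 0 < (q - p) / q `^ b2 by exact: divr_gt0.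
have -> : (u / lambda a1 a2 p q) `^ (1 / beta)
    = (q - p) * M / (p `^ b2 * q `^ b2).
  have -> : u / lambda a1 a2 p q = u * ((q - p) / q `^ b2 * p `^ (- b2)) `^ beta.
    congr (_ * _); rewrite /lambda eD invf_div [RHS]powRM ?powR_ge0 ?(ltW L0)//.
    by rewrite -powRrM mulNr divfK ?gt_eqF// powRN.
  rewrite powRM ?powR_ge0 ?(ltW u_gt0)// -powRrM.
  rewrite mul1r divff ?gt_eqF// powRr1 ?(mulr_ge0 (ltW L0)) ?powR_ge0// powRN.
  by field; rewrite !gt_eqF.
rewrite ler_pdivlMr ?mulr_gt0//; congr (_ <= _).
by rewrite ed1 ed2; field; rewrite !gt_eqF.
Qed.

Lemma f_u_ge1 (x : 'rV[R]_2) : 1 <= beta -> 0 <= x 0 0 -> 0 <= x 0 1 ->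
  f_u a1 a2 l u x = z0 beta l u + slope * G (x 0 0) (x 0 1).
Proof.
move=> b x0 y0; rewrite /f_u b /gamma powRM ?powR_ge0 ?mulr_ge0 ?powR_ge0//.
by rewrite cobb_douglas_root// -powRrM (mulrC beta) divfK ?gt_eqF// powRr1// ltW.
Qed.

(** The line through [(m, l)] and [(M, u)], in Lagrange form. *)
Lemma z0E t :
  z0 beta l u + slope * t = l * (M - t) / (M - m) + u * (t - m) / (M - m).
Proof. by rewrite /z0; field; rewrite subr_eq0 gt_eqF. Qed.

(** For [beta >= 1] the root is concave, hence above its chord on [[l, u]]; the increasing affine
    map given by [z0] and [slope] sends the chord value back to [x]. *)
Lemma secant_le x : 1 <= beta -> l <= x -> x <= u ->
  x <= z0 beta l u + slope * x `^ (1 / beta).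
Proof.
move=> b lx xu; pose t := (u - x) / (u - l).
have ul : 0 < u - l by rewrite subr_gt0.
have t0 : 0 <= t by rewrite divr_ge0 ?subr_ge0// ltW.
have t1 : t <= 1 by rewrite ler_pdivrMr// mul1r lerB.
have ex : x = t * l + (1 - t) * u by rewrite /t; field; rewrite gt_eqF.
have := @powR_concave R (1 / beta) t l u.
rewrite -ex => h.
have {}h : t * m + (1 - t) * M <= x `^ (1 / beta).
  apply: h => //; first by rewrite divr_ge0// ltW.
  by rewrite ler_pdivrMr// mul1r.
apply: (@le_trans _ _ (z0 beta l u + slope * (t * m + (1 - t) * M))); last first.
  by rewrite lerD2l ler_wpM2l// ltW.
by rewrite z0E {1}ex le_eqVlt; apply/orP; left; apply/eqP; field;
  rewrite subr_eq0 gt_eqF.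
Qed.

(** * The right-hand side: convexity and inclusion of the hypograph *)

Local Notation E := [set xz : 'rV[R]_2 * R^o |
  [/\ set_Y a1 a2 p q l u xz.1, (xz.2 : R) <= f_u a1 a2 l u xz.1
    & (xz.2 : R) <= u]].

(** Replacing [F] by the concave [G] makes the lower bound a superlevel condition that passes to
    convex combinations, as the linear [chord] bound does. *)
Lemma envelopeE (v : 'rV[R]_2) (z : R^o) :
  E (v, z) <-> [/\ [/\ 0 < v 0 0, 0 < v 0 1, p * v 0 0 <= v 0 1
                     & v 0 1 <= q * v 0 0],
                   m <= G (v 0 0) (v 0 1),
                   chord (v 0 0) (v 0 1) <= (q - p) * M,
                   z <= f_u a1 a2 l u v & z <= u].
Proof.
split=> /=.
  move=> [[v0 /andP[pv vq] lF]]; rewrite set_Y_chordE => c zf zu.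
  have [x0 y0] : 0 < v 0 0 /\ 0 < v 0 1.
    by apply: cobb_douglas_gt0 => //; exact: lt_le_trans lF.
  by split=> //; rewrite -root_leE// ltW.
move=> [[x0 y0 pv vq] mG c zf zu]; split=> //; split.
- by apply/nonneg_orthant2P; rewrite !ltW.
- by rewrite pv.
- by rewrite root_leE// ltW.
- by rewrite set_Y_chordE.
Qed.

Lemma hypograph_sub_envelope :
  hypograph (monomial a1 a2) (set_X a1 a2 l u `&` set_W12 p q) `<=` E.
Proof.
move=> [v z] /= [[[v0 /andP[lF Fu]] [_ /andP[pv vq]]] zF].
rewrite /monomial in lF Fu zF.
have [x0 y0] : 0 < v 0 0 /\ 0 < v 0 1.
  by apply: cobb_douglas_gt0 => //; exact: lt_le_trans lF.
apply/envelopeE; split=> //.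
- by rewrite -root_leE// ltW.
- apply: le_trans (chord_le x0 pv vq) _; rewrite ler_wpM2l ?subr_ge0 ?(ltW hpq)//.
  rewrite -(cobb_douglas_root (ltW x0) (ltW y0)).
  by apply: ge0_ler_powR; rewrite ?nnegrE ?divr_ge0 ?mulr_ge0 ?powR_ge0// ?ltW.
- apply: le_trans zF _; have [b|b] := leP 1 beta.
    rewrite (f_u_ge1 b (ltW x0) (ltW y0)).
    by rewrite -(cobb_douglas_root (ltW x0) (ltW y0)) secant_le.
  by rewrite /f_u (lt_geF b).
- exact: le_trans Fu.
Qed.

Lemma convex_envelope : convex_set (E : set ('rV[R]_2 * R^o)%type).
Proof.
move=> [v z] [w s] k /set_mem/envelopeE[[v0 v1 pv vq] mv cv zv zu].
move=> /set_mem/envelopeE[[w0 w1 pw wq] mw cw sw su]; apply/mem_set.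
set t : R := k%:num.
have t0 : 0 <= t by apply: (@ge0 R _ k).
have t1 : t <= 1 by apply: (@le1 R _ k).
have t1' : 0 <= 1 - t by rewrite subr_ge0.
change (E (t *: v + (1 - t) *: w, t * z + (1 - t) * s)).
have GG : t * G (v 0 0) (v 0 1) + (1 - t) * G (w 0 0) (w 0 1)
    <= G (t * v 0 0 + (1 - t) * w 0 0) (t * v 0 1 + (1 - t) * w 0 1).
  by apply: powRM_concave; rewrite ?b1D// ltW.
have comb a b c d : a <= c -> b <= d -> t * a + (1 - t) * b <= t * c + (1 - t) * d.
  by move=> ac bd; rewrite lerD// ler_wpM2l.
have combK a : t * a + (1 - t) * a = a by ring.
apply/envelopeE; rewrite !mxE; split.
- split; [exact: conv_gt0|exact: conv_gt0| |].
  + rewrite [leLHS](_ : _ = t * (p * v 0 0) + (1 - t) * (p * w 0 0)); last ring.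
    exact: comb.
  + rewrite [leRHS](_ : _ = t * (q * v 0 0) + (1 - t) * (q * w 0 0)); last ring.
    exact: comb.
- by apply: le_trans GG; rewrite -(combK m) comb.
- rewrite -(combK ((q - p) * M)).
  rewrite [leLHS](_ : _ = t * chord (v 0 0) (v 0 1)
     + (1 - t) * chord (w 0 0) (w 0 1)); last ring.
  exact: comb.
(* If [beta >= 1], [f_u] is an increasing affine function of [G]; otherwise it is [F], with
   exponents of sum below 1. Both are concave. *)
- have [b|b] := leP 1 beta.
    move: zv sw; rewrite (f_u_ge1 b (ltW v0) (ltW v1)).
    rewrite (f_u_ge1 b (ltW w0) (ltW w1)) f_u_ge1 ?mxE//; do ?[exact/ltW/conv_gt0].
    move=> zv sw.
    apply: le_trans (comb _ _ _ _ zv sw) _.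
    apply: (@le_trans _ _ (z0 beta l u + slope * (t * G (v 0 0) (v 0 1)
        + (1 - t) * G (w 0 0) (w 0 1)))); last by rewrite lerD2l ler_wpM2l// ltW.
    by rewrite le_eqVlt; apply/orP; left; apply/eqP; ring.
  move: zv sw; rewrite /f_u (lt_geF b) /= /monomial !mxE => zv sw.
  apply: le_trans (comb _ _ _ _ zv sw) _.
  by apply: powRM_concave => //; exact: ltW.
- by rewrite -(combK u) comb.
Qed.

(** * Points of the right-hand side as combinations of hypograph points *)

Lemma scaled_in_hypograph (v : 'rV[R]_2) c z : 0 < v 0 0 -> 0 < v 0 1 ->
  p * v 0 0 <= v 0 1 -> v 0 1 <= q * v 0 0 -> 0 < c ->
  z <= c `^ beta * F (v 0 0) (v 0 1) ->
  l <= c `^ beta * F (v 0 0) (v 0 1) <= u ->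
  hypograph (monomial a1 a2) (set_X a1 a2 l u `&` set_W12 p q) (c *: v, z).
Proof.
move=> x0 y0 pv vq c0 zF lFu.
have cv0 : nonneg_orthant R 2 (c *: v).
  by apply/nonneg_orthant2P; rewrite !mxE !mulr_ge0// ltW.
have fE : monomial a1 a2 (c *: v) = c `^ beta * F (v 0 0) (v 0 1).
  by rewrite /monomial !mxE (cobb_douglasZ (ltW c0) (ltW x0) (ltW y0)).
split=> /=; last by rewrite fE.
split; split=> //=; first by rewrite fE.
by rewrite !mxE !(mulrCA _ c) !ler_pM2l// pv vq.
Qed.

Lemma envelope_above (A : set ('rV[R]_2 * R^o)%type) (v : 'rV[R]_2) z :
  convex_set A ->
  hypograph (monomial a1 a2) (set_X a1 a2 l u `&` set_W12 p q) `<=` A ->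
  0 < v 0 0 -> 0 < v 0 1 -> p * v 0 0 <= v 0 1 -> v 0 1 <= q * v 0 0 ->
  M < G (v 0 0) (v 0 1) -> chord (v 0 0) (v 0 1) <= (q - p) * M -> z <= u ->
  A (v, z).
Proof.
move=> cA hA x0 y0 pv vq MG cM zu.
set x := v 0 0 in x0 pv vq MG cM *; set y := v 0 1 in y0 pv vq MG cM *.
have qp : 0 < q - p by rewrite subr_gt0.
have P0 : 0 < p `^ b2 by exact: powR_gt0.
have Q0 : 0 < q `^ b2 by exact: powR_gt0.
have M0 : 0 < M by exact: lt_trans m_lt_M.
have G0 : 0 < G x y by exact: lt_trans MG.
have c0 : 0 < chord x y.
  have [h|h] := ltP (p * x) y.
    by rewrite ltr_wpDl ?mulr_gt0 ?subr_gt0// mulr_ge0 ?subr_ge0// ltW.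
  have -> : y = p * x by apply/eqP; rewrite eq_le h.
  by rewrite subrr mulr0 addr0 -mulrBl !mulr_gt0.
have uF : (M / G x y) `^ beta * F x y = u.
  rewrite (cobb_douglasE (ltW x0) (ltW y0)) -powRM ?divr_ge0 ?(ltW M0) ?(ltW G0)//.
  by rewrite divfK ?gt_eqF// powR_rootK// ltW.
have near : A (M / G x y *: v, z).
  by apply/hA/scaled_in_hypograph; rewrite ?divr_gt0 ?uF ?(ltW hlu) ?lexx.
have extreme r : 0 < r -> p <= r -> r <= q ->
    A (M / r `^ b2 *: \row_i (if i == 0 then 1 else r), z).
  move=> r0 pr rq; have Z0 : 0 < r `^ b2 by exact: powR_gt0.
  have uE : (M / r `^ b2) `^ beta * F 1 r = u.
    rewrite (cobb_douglasE ler01 (ltW r0)) powR1 /= (mul1r (r `^ _)).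
    rewrite -powRM ?(ltW Z0) ?divr_ge0 ?(ltW M0) ?(ltW Z0)//.
    by rewrite divfK ?gt_eqF// powR_rootK// ltW.
  by apply/hA/scaled_in_hypograph; rewrite ?mxE/= ?mulr1 ?divr_gt0 ?uE
    ?(ltW hlu) ?lexx.
(* [far] is the point of the ray through [v] on the segment joining the two
   extreme points: [(q - p) * M] is the value of [chord] there. *)
have far : A ((q - p) * M / chord x y *: v, z).
  (* The weight is the share of the first summand in [chord x y]; the second summand gives the
     weight on the ray of slope [q]. *)
  have := convex_graph_space (t := p `^ b2 * (q * x - y) / chord x y) cA
    (extreme p hp (lexx p) (ltW hpq)) (extreme q q_gt0 (ltW hpq) (lexx q)).
  rewrite [X in A (_, X)](_ : _ = z); last ring.
  have -> : p `^ b2 * (q * x - y) / chord x y *: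
       (M / p `^ b2 *: \row_i (if i == 0 then 1 else p))
     + (1 - p `^ b2 * (q * x - y) / chord x y) *:
       (M / q `^ b2 *: \row_i (if i == 0 then 1 else q))
     = (q - p) * M / chord x y *: v.
    by apply: rV2P; rewrite !mxE /= -/x -/y; field; rewrite !gt_eqF.
  apply; first by rewrite divr_ge0 ?mulr_ge0 ?subr_ge0 ?(ltW c0) ?(ltW P0).
  rewrite ler_pdivrMr// mul1r lerDl mulr_ge0 ?subr_ge0//; exact: ltW.
have a1' : M / G x y < 1 by rewrite ltr_pdivrMr// (mul1r (G x y)).
have b1' : 1 <= (q - p) * M / chord x y by rewrite ler_pdivlMr// (mul1r (chord x y)).
apply: (convex_ray cA (ltW a1') b1' (lt_le_trans a1' b1') near far).
ring.
Qed.

Lemma envelope_below (A : set ('rV[R]_2 * R^o)%type) (v : 'rV[R]_2) z :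
  convex_set A ->
  hypograph (monomial a1 a2) (set_X a1 a2 l u `&` set_W12 p q) `<=` A ->
  0 < v 0 0 -> 0 < v 0 1 -> p * v 0 0 <= v 0 1 -> v 0 1 <= q * v 0 0 ->
  m <= G (v 0 0) (v 0 1) -> G (v 0 0) (v 0 1) <= M ->
  z <= z0 beta l u + slope * G (v 0 0) (v 0 1) ->
  A (v, z).
Proof.
move=> cA hA x0 y0 pv vq mG GM zG.
have G0 : 0 < G (v 0 0) (v 0 1) by exact: lt_le_trans mG.
have M0 : 0 < M by exact: lt_trans m_lt_M.
(* By homogeneity this factor moves [v] along its ray to level [k]. *)
have FE k : 0 <= k ->
    (k `^ (1 / beta) / G (v 0 0) (v 0 1)) `^ beta * F (v 0 0) (v 0 1) = k.
  move=> k0; rewrite (cobb_douglasE (ltW x0) (ltW y0)) -powRM ?(ltW G0)//.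
    by rewrite divfK ?gt_eqF// powR_rootK.
  by rewrite divr_ge0 ?powR_ge0 ?(ltW G0).
(* Lowering both ends by the same [d] makes the segment pass through [z]. *)
pose d := z0 beta l u + slope * G (v 0 0) (v 0 1) - z.
have d0 : 0 <= d by rewrite subr_ge0.
have at_level k : l <= k -> k <= u ->
    A (k `^ (1 / beta) / G (v 0 0) (v 0 1) *: v, k - d).
  move=> lk ku; have k0 : 0 < k by exact: lt_le_trans lk.
  apply/hA/scaled_in_hypograph => //.
  - by rewrite divr_gt0// powR_gt0.
  - by rewrite (FE k (ltW k0)) gerBl.
  - by rewrite (FE k (ltW k0)) lk.
apply: (convex_ray cA _ _ _ (at_level l _ _) (at_level u _ _)) => //;
  rewrite ?(ltW hlu)//.
- by rewrite ler_pdivrMr// (mul1r (G _ _)).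
- by rewrite ler_pdivlMr// (mul1r (G _ _)).
- by rewrite ltr_pM2r// invr_gt0.
(* Interpolating [l] and [u] along the ray gives the secant value at [G]; subtracting [d] leaves
   [z]. *)
- rewrite /d z0E; field.
  by rewrite subr_eq0 !gt_eqF ?powR_gt0.
Qed.

Lemma envelope_sub_hull (A : set ('rV[R]_2 * R^o)%type) :
  convex_set A ->
  hypograph (monomial a1 a2) (set_X a1 a2 l u `&` set_W12 p q) `<=` A ->
  E `<=` A.
Proof.
move=> cA hA [v z] /envelopeE[[x0 y0 pv vq] mG cM zf zu].
have [MG|GM] := ltP M (G (v 0 0) (v 0 1)); first exact: envelope_above.
have [b|b] := leP 1 beta.
  apply: envelope_below => //.
  by rewrite -(f_u_ge1 b (ltW x0) (ltW y0)).
(* Here [beta < 1] and [G <= M], so the point already lies in the hypograph. *)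
move: zf; rewrite /f_u (lt_geF b) => zf; apply: hA.
rewrite -[v]scale1r; apply: scaled_in_hypograph => //; rewrite powR1 mul1r//.
rewrite (root_leE (ltW x0) (ltW y0) (ltW hl)) mG /=.
rewrite -[leRHS]powR_rootK ?(ltW u_gt0)// (cobb_douglasE (ltW x0) (ltW y0)).
by apply: ge0_ler_powR; rewrite ?nnegrE ?mulr_ge0 ?powR_ge0// ltW.
Qed.

End Envelope.

Theorem theorem1 (R : realType) (a1 a2 p q l u : R)
    (ha1 : 0 < a1) (ha2 : 0 < a2) (hp : 0 < p) (hpq : p < q)
    (hl : 0 < l) (hlu : l < u) :
  upper_envelope (monomial a1 a2) (set_X a1 a2 l u `&` set_W12 p q) =
  [set xz : 'rV[R]_2 * R^o | [/\ set_Y a1 a2 p q l u xz.1,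
                                 (xz.2 : R) <= f_u a1 a2 l u xz.1
                               & (xz.2 : R) <= u]].
Proof.
apply/seteqP; split.
  by apply: smallest_sub; [exact: convex_envelope|exact: hypograph_sub_envelope].
by move=> xz Exz A [cA hA]; exact: (envelope_sub_hull _ _ _ _ _ _ cA hA).
Qed.
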